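(* Let $n\ge 1$, let $\gamma\in\mathbb{R}$ with $|\gamma|\le 2$, and let $0<\alpha_i,\beta_i\le 2$ $(i=1,\dots,n)$ satisfy $\alpha_i\ne\beta_j$ for all $i,j=1,\dots,n$, and $\alpha_i\le\alpha_j$, $\beta_i\le\beta_j$ whenever $1\le i<j\le n$. If $$0\le \gamma-\sum_{i=1}^n F(\beta_i,\alpha_i)\quad\text{and}\quad \gamma+\sum_{i=1}^n F(\alpha_i,\beta_i)\le 1,$$ then the function $$f(t)=\begin{cases} t^\gamma\prod_{i=1}^n \dfrac{t^{\alpha_i}-1}{t^{\beta_i}-1} & \text{if } t\ne 1,\\[2mm] \prod_{i=1}^n \dfrac{\alpha_i}{\beta_i} & \text{if } t=1\end{cases}$$ is operator monotone on $(0,\infty)$.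
   Context: The function $F:[0,2]\times[0,2]\to\mathbb{R}$ is defined by $$F(a,b)=\begin{cases} a-b & \text{if } a\ge b,\ 0\le b\le 1,\\ a-1 & \text{if } 1<a,b\le 2,\\ 0 & \text{if } a<b,\ 0\le a\le 1.\end{cases}$$ A real-valued continuous function $g$ on $(0,\infty)$ is called operator monotone on $(0,\infty)$ if for all positive invertible bounded linear operators $A,B$ on a Hilbert space, $0<A\le B$ implies $g(A)\le g(B)$, where $g(A)$ is the continuous functional calculus. *)

(* Defs.v *)
From HB Require Import structures.
From mathcomp Require Import all_boot all_order all_algebra.
From mathcomp Require Import complex.
From mathcomp Require Import all_classical all_reals all_analysis.

Set Implicit Arguments.
Unset Strict Implicit.
Unset Printing Implicit Defensive.

Import Order.TTheory GRing.Theory Num.Theory numFieldNormedType.Exports.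

Local Open Scope classical_set_scope.
Local Open Scope complex_scope.
Local Open Scope ring_scope.

(* The values of F outside [0,2] x [0,2] are irrelevant; on that square the
   last branch is exactly the case a < b, 0 <= a <= 1. *)
Definition F {R : realType} (a b : R) : R :=
  if (b <= a) && (0 <= b <= 1) then a - b
  else if (1 < a <= 2) && (1 < b <= 2) then a - 1
  else 0.

(* Complex Hilbert spaces of arbitrary dimension.  The norm of a normed module
   over R[i] takes its (real, nonnegative) values in R[i]. *)
Record hilbertSpace (R : realType) := HilbertSpace {
  hilbert_sort :> completeNormedModType R[i];
  inner : {dot hilbert_sort for Num.conj};
  inner_normE : forall x : hilbert_sort, `|x| ^+ 2 = inner x x
}.

Record boundedOp {R : realType} (H : hilbertSpace R) := BoundedOp {
  op_linear :> {linear H -> H};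
  op_continuous : continuous op_linear
}.

Section operators.
Context {R : realType} {H : hilbertSpace R}.
Implicit Types A B : boundedOp H.

Definition invertible_op (T : H -> H) : Prop :=
  exists S : boundedOp H, cancel T S /\ cancel S T.

(* The order of R[i] is partial: 0 <= z entails that z is real. *)
Definition positive_op A : Prop := forall x : H, 0 <= inner H (A x) x.

Definition op_le A B : Prop := forall x : H, 0 <= inner H (B x - A x) x.

Definition spectrum A : set R[i] :=
  [set z | ~ invertible_op (fun x => A x - z *: x)].

(* For positive A the spectrum lies on the real axis, so nothing is lost. *)
Definition real_spectrum A : set R := [set t | spectrum A t%:C].

(* Phi is the continuous functional calculus h |-> h(A) of the self-adjoint
   operator A, on real-valued functions: the unique unital *-homomorphism from
   the real continuous functions on the spectrum of A to the bounded operators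
   which is bounded for the sup norm and maps the identity function to A.
   A function on the spectrum is represented by any function R -> R extending
   it; by fc_add and fc_bounded, Phi h does not depend on the extension.  For
   real h the identity Phi (conj h) = (Phi h)^* says that Phi h is
   self-adjoint. *)
Record is_functional_calculus A (Phi : (R -> R) -> boundedOp H) : Prop :=
  IsFunctionalCalculus {
  fc_one : Phi (fun=> 1) =1 id;
  fc_id : Phi id =1 A;
  fc_add : forall h k : R -> R,
    {within real_spectrum A, continuous h} ->
    {within real_spectrum A, continuous k} ->
    forall x, Phi (fun t => h t + k t) x = Phi h x + Phi k x;
  fc_scale : forall (c : R) (h : R -> R),
    {within real_spectrum A, continuous h} ->
    forall x, Phi (fun t => c * h t) x = c%:C *: Phi h x;
  fc_mul : forall h k : R -> R,
    {within real_spectrum A, continuous h} ->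
    {within real_spectrum A, continuous k} ->
    forall x, Phi (fun t => h t * k t) x = Phi h (Phi k x);
  fc_adjoint : forall h : R -> R,
    {within real_spectrum A, continuous h} ->
    forall x y, inner H (Phi h x) y = inner H x (Phi h y);
  fc_bounded : exists M : R, forall (h : R -> R) (c : R),
    {within real_spectrum A, continuous h} ->
    (forall t, real_spectrum A t -> `|h t| <= c) ->
    forall x, `|Phi h x| <= (M * c)%:C * `|x|
}.

End operators.

(* Only the values of g on (0, +oo) matter, since the spectrum of a positive
   invertible operator is contained in (0, +oo). *)
Definition operator_monotone {R : realType} (g : R -> R) : Prop :=
  {within [set t : R | 0 < t], continuous g} /\
  forall (H : hilbertSpace R) (A B : boundedOp H)
         (PhiA PhiB : (R -> R) -> boundedOp H),
    positive_op A -> invertible_op A ->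
    positive_op B -> invertible_op B ->
    is_functional_calculus A PhiA -> is_functional_calculus B PhiB ->
    op_le A B -> op_le (PhiA g) (PhiB g).

(* Main.v *)
(** A function f has an analytic continuation with 0 <= arg f(z) <= c arg z in
    the upper half-plane exactly when f^(1/c) is operator monotone.  This
    replaces complex analysis by closure properties.  Operator monotone
    functions are closed under sums, parallel sums (1/f + 1/g)^-1 and locally
    uniform limits.  Hence they are closed under geometric means f^(1-p) g^p
    (arithmetic-harmonic mean iteration and bisection of p), under power means
    (f^p + g^p)^(1/p) with 0 < p <= 1 (Euler's method for
    dS/dw = S^(1-p) g^p / p, each step of which adds a geometric mean), and so,
    by Riemann sums of
    (t^a - 1)/(t^b - 1) = (a/b) \int_0^1 (1 + s (t^b - 1))^(a/b - 1) ds,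
    they contain ((t^a - 1)/(t^b - 1))^(1/(a-b)) for 0 < b <= 1, b < a <= b + 1.
    The substitution f |-> 1/f(1/t) exchanges a and b, and the case a, b > 1 is
    the product of the cases (a, 1) and (1, b): each factor
    t^F(beta_i, alpha_i) (t^alpha_i - 1)/(t^beta_i - 1) is the c_i-th power of
    an operator monotone function, c_i = F(alpha_i, beta_i) + F(beta_i, alpha_i).
    The hypotheses say that these exponents and that of the remaining power of
    t are nonnegative with sum at most 1, so that f is a weighted geometric
    mean. *)

Require Import Defs.
From mathcomp Require Import all_boot all_order all_algebra.
From mathcomp Require Import complex ring lra.
From mathcomp Require Import all_classical all_reals all_analysis.

Set Implicit Arguments.
Unset Strict Implicit.
Unset Printing Implicit Defensive.

Import Order.TTheory GRing.Theory Num.Theory numFieldNormedType.Exports.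
Local Open Scope classical_set_scope.
Local Open Scope complex_scope.
Local Open Scope ring_scope.

(** * Real powers *)

Section real_powers.
Context {R : realType}.
Implicit Types (x y p q s e : R).

Lemma powR_expR x p : 0 < x -> x `^ p = expR (p * ln x).
Proof. by move=> x0; rewrite /powR gt_eqF. Qed.

Lemma powRD_gt0 x p q : 0 < x -> x `^ (p + q) = x `^ p * x `^ q.
Proof. by move=> x0; apply: powRD; rewrite (gt_eqF x0) implybT. Qed.

Lemma powRVl x p : 0 < x -> x^-1 `^ p = (x `^ p)^-1.
Proof. by move=> x0; rewrite -powR_inv1 ?ltW// powRAC powR_inv1 ?powR_ge0. Qed.

Lemma powRK x p : p != 0 -> 0 < x -> (x `^ p) `^ p^-1 = x.
Proof. by move=> p0 x0; rewrite -powRrM mulfV// powRr1// ltW. Qed.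

Lemma powRKV x p : p != 0 -> 0 < x -> (x `^ p^-1) `^ p = x.
Proof. by move=> p0 x0; rewrite -powRrM mulVf// powRr1// ltW. Qed.

(** Young's inequality for [x] and 1 with the conjugate exponents [q] and [q / (q - 1)], multiplied
    by [q]. *)
Lemma bernoulli_powR x q : 0 <= x -> 1 < q -> 1 + q * (x - 1) <= x `^ q.
Proof.
move=> x0 q1; have q0 : 0 < q by lra.
have q1' : 0 < q - 1 by lra.
have := @conjugate_powR R x 1 q (q / (q - 1)) x0 ler01.
rewrite powR1 mulr1 => /(_ q0 _ _).
have -> : q^-1 + (q / (q - 1))^-1 = 1 by field; lra.
move=> /(_ (divr_gt0 q0 q1') erefl).
have -> : x `^ q / q + 1 / (q / (q - 1)) = (x `^ q + (q - 1)) / q by field; lra.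
by rewrite ler_pdivlMr//; lra.
Qed.

Lemma ln1D_ge x : 0 <= x -> x / (1 + x) <= ln (1 + x).
Proof.
move=> x0; have h : 0 < 1 + x by lra.
rewrite -lerN2 -lnV ?posrE//.
have e : (1 + x)^-1 = 1 + - (x / (1 + x)) by field; lra.
by rewrite {1}e; apply: le_ln1Dx; rewrite ltrN2 ltr_pdivrMr//; lra.
Qed.

(* One Euler step for the equation dS/dw = S^(1-p) Y / p, whose solutions are
   S(w) = (S(0)^p + w Y)^(1/p). *)
Lemma euler_step p d D s Y : 0 < p <= 1 -> 0 < d -> 0 < s -> 0 < Y ->
  Y <= D * s `^ p ->
  s `^ p + d * Y / (1 + d * D / p) <= (s + d / p * (s `^ (1 - p) * Y)) `^ p
    <= s `^ p + d * Y * expR (d * D).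
Proof.
move=> /andP[p0 p1] d0 s0 Y0 YD.
have sp0 : 0 < s `^ p by rewrite powR_gt0.
(* In terms of [c] the step multiplies [s] by 1 + d c / p, so only (1 + d c / p)^p has to be
   bounded; [D] makes the bounds independent of [s] and [Y]. *)
set c := Y / s `^ p.
have c0 : 0 < c by rewrite divr_gt0.
have cD : c <= D by rewrite ler_pdivrMr.
have YE : Y = c * s `^ p by rewrite /c divfK ?gt_eqF.
clearbody c.
have dc0 : 0 < d * c by rewrite mulr_gt0.
have w0 : 0 < d * c / p by rewrite divr_gt0.
have -> : s + d / p * (s `^ (1 - p) * Y) = s * (1 + d * c / p).
  have sE : s = s `^ (1 - p) * s `^ p.
    by rewrite -powRD_gt0// subrK powRr1// ltW.
  by rewrite YE [X in X + _]sE [X in _ = X * _]sE; ring.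
have h1 : 0 < 1 + d * c / p by lra.
rewrite powRM ?(ltW s0) ?(ltW h1)//.
have lo : 1 + d * c / (1 + d * c / p) <= (1 + d * c / p) `^ p.
  rewrite powR_expR//; apply: le_trans (expR_ge1Dx _).
  rewrite lerD2l; have := ln1D_ge (ltW w0).
  move/(ler_wpM2l (ltW p0)); apply: le_trans.
  by rewrite le_eqVlt; apply/orP; left; apply/eqP; field; rewrite !gt_eqF//; lra.
have hi : (1 + d * c / p) `^ p <= 1 + d * c * expR (d * D).
  rewrite powR_expR//; apply: (@le_trans _ _ (expR (d * c))).
    rewrite ler_expR; have := @le_ln1Dx R (d * c / p).
    move=> /(_ _)/(ler_wpM2l (ltW p0)) -/(_ _).
    have -> : p * (d * c / p) = d * c by field; rewrite gt_eqF.
    by apply; lra.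
  apply: (@le_trans _ _ (1 + d * c * expR (d * c))); last first.
    by rewrite lerD2l ler_wpM2l ?(ltW dc0)// ler_expR ler_wpM2l// ltW.
  have := expR_ge1Dx (- (d * c)); rewrite expRN => h.
  have e0 := expR_gt0 (d * c).
  have := ler_wpM2r (ltW e0) h; rewrite mulVf ?gt_eqF//; nra.
apply/andP; split.
  apply: (@le_trans _ _ (s `^ p * (1 + d * c / (1 + d * c / p)))); last first.
    by rewrite ler_wpM2l ?powR_ge0.
  rewrite mulrDr mulr1 lerD2l YE.
  have -> : s `^ p * (d * c / (1 + d * c / p)) =
            d * (c * s `^ p) / (1 + d * c / p) by ring.
  have dcD : d * c / p <= d * D / p.
    by rewrite ler_wpM2r ?invr_ge0 ?(ltW p0)// ler_wpM2l ?(ltW d0).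
  apply: ler_wpM2l; first by rewrite !mulr_ge0// ltW.
  by rewrite lef_pV2 ?posrE//; lra.
apply: (@le_trans _ _ (s `^ p * (1 + d * c * expR (d * D)))).
  by rewrite ler_wpM2l ?powR_ge0.
by rewrite mulrDr mulr1 lerD2l YE le_eqVlt; apply/orP; left; apply/eqP; ring.
Qed.

Lemma exists_nat_le (C e : R) : 0 < e -> exists n : nat, C / n.+1%:R <= e.
Proof.
move=> e0; exists (Num.bound `|C / e|).
have := lt_le_trans (archi_boundP (normr_ge0 (C / e))) (_ : _ <= (Num.bound `|C / e|).+1%:R).
rewrite ler_nat leqnSn => /(_ isT) /ltW/(le_trans (ler_norm _)).
by rewrite !ler_pdivrMr ?ltr0n// mulrC.
Qed.

Lemma exists_exp2_le (C e : R) : 0 <= C -> 0 < e -> exists n : nat, C / 2 ^+ n <= e.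
Proof.
move=> C0 e0; have [n h] := exists_nat_le C e0; exists n.
apply: le_trans h; rewrite ler_wpM2l// lef_pV2 ?posrE ?exprn_gt0 ?ltr0n//.
by rewrite -natrX ler_nat ltn_expl.
Qed.

End real_powers.
(** * Classes of functions closed under means *)

(** For positive functions this is uniform closeness of logarithms: it is invariant under inversion,
    and powers only rescale [e]. *)
Definition log_close {R : realType} {T : Type} (K : set T) (e : R) (f g : T -> R) :=
  forall t, K t -> f t <= expR e * g t /\ g t <= expR e * f t.

(** Two instances matter: continuous functions with positive bounds, and those among them with f(A)
    <= f(B). One derivation from the axioms thus yields both continuity and operator
    monotonicity. *)
Record mean_class {R : realType} {T : Type} (K : set T) (P : (T -> R) -> Prop) :
    Prop := MeanClass {
  mc_bounded : forall f, P f ->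
    exists l u, 0 < l /\ forall t, K t -> l <= f t <= u;
  mc_one : P (fun=> 1);
  mc_scale : forall c f, 0 < c -> P f -> P (fun t => c * f t);
  mc_add : forall f g, P f -> P g -> P (fun t => f t + g t);
  mc_par : forall f g, P f -> P g -> P (fun t => ((f t)^-1 + (g t)^-1)^-1);
  mc_closed : forall f,
    (forall e, 0 < e -> exists2 g, P g & log_close K e f g) -> P f
}.

Section mean_class.
Context {R : realType} {T : Type} {K : set T} {P : (T -> R) -> Prop}.
Hypothesis mcP : mean_class K P.
Implicit Types (f g h : T -> R) (t : T).

Lemma mc_gt0 f t : P f -> K t -> 0 < f t.
Proof.
by move=> /(mc_bounded mcP)[l [u [l0 h]]] /h/andP[+ _]; exact: lt_le_trans.
Qed.

(** Membership depends only on values on [K], since [f] approximates [g] to every precision. *)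
Lemma mc_eq f g : P f -> (forall t, K t -> f t = g t) -> P g.
Proof.
move=> Pf fg; apply: (mc_closed mcP) => e e0; exists f => // t Kt.
have := mc_gt0 Pf Kt; rewrite -fg// => ft0.
by split; rewrite ler_peMl ?(ltW ft0)// ltW ?expR_gt1.
Qed.

Lemma mc_log_bounded f : P f -> exists2 C, 0 < C & forall t, K t -> `|ln (f t)| <= C.
Proof.
move=> Pf; have [l [u [l0 h]]] := mc_bounded mcP Pf.
exists (1 + `|ln l| + `|ln u|).
  by rewrite -addrA ltr_pwDl ?addr_ge0.
move=> t /h/andP[lf fu]; have f0 := lt_le_trans l0 lf.
have u0 := lt_le_trans f0 fu.
have : ln l <= ln (f t) by rewrite ler_ln ?posrE.
have : ln (f t) <= ln u by rewrite ler_ln ?posrE.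
have := ler_norm (ln u); have := ler_norm (- ln l); rewrite normrN.
have := normr_ge0 (ln u); have := normr_ge0 (ln l).
by move=> *; rewrite ler_norml; apply/andP; split; lra.
Qed.

Lemma mc_sqrt f g : P f -> P g -> P (fun t => Num.sqrt (f t * g t)).
Proof.
move=> Pf Pg.
have [lf [uf [lf0 hf]]] := mc_bounded mcP Pf.
have [lg [ug [lg0 hg]]] := mc_bounded mcP Pg.
pose r t := Num.sqrt (f t * g t).
have fg0 t : K t -> 0 < f t * g t by move=> Kt; rewrite mulr_gt0// mc_gt0.
have r0 t : K t -> 0 < r t by move=> Kt; rewrite sqrtr_gt0 fg0.
have rr t : K t -> r t * r t = f t * g t.
  by move=> Kt; rewrite -expr2 sqr_sqrtr ?(ltW (fg0 _ Kt)).
(* arithmetic-harmonic iteration: f g / a is the harmonic companion of a *)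
have step n : exists a, [/\ P a, P (fun t => f t * g t / a t) &
    forall t, K t -> r t <= a t <= r t + (`|uf| + `|ug|) / 2 ^+ n].
  elim: n => [|n [a [Pa Pb ha]]].
    exists (fun t => f t + g t); split; first exact: (mc_add mcP).
      apply: (mc_eq (mc_par mcP Pf Pg)) => t Kt.
      have := mc_gt0 Pf Kt; have := mc_gt0 Pg Kt => *; field; lra.
    move=> t Kt; have := mc_gt0 Pf Kt; have := mc_gt0 Pg Kt.
    have := hf _ Kt; have := hg _ Kt; have := r0 _ Kt; have := rr _ Kt.
    have := ler_norm uf; have := ler_norm ug; rewrite expr0 divr1.
    move=> ? ? rE ? /andP[? ?] /andP[? ?] ? ?.
    apply/andP; split; last by lra.
    by rewrite leNgt; apply/negP => ?; nra.
  exists (fun t => 2^-1 * (a t + f t * g t / a t)); split.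
  - by apply: (mc_scale mcP); [lra|exact: (mc_add mcP)].
  - have c2 : 0 < 2 :> R by lra.
    apply: (mc_eq (mc_scale mcP c2 (mc_par mcP Pa Pb))) => t Kt.
    have at0 := mc_gt0 Pa Kt; have f0 := mc_gt0 Pf Kt; have g0 := mc_gt0 Pg Kt.
    have ? := fg0 _ Kt.
    by field; rewrite !gt_eqF//= ?addr_gt0// ?mulr_gt0.
  - move=> t Kt; have at0 := mc_gt0 Pa Kt.
    have /andP[ra ar] := ha _ Kt; have r0t := r0 _ Kt.
    set D := _ / _ in ar *.
    have -> : (`|uf| + `|ug|) / 2 ^+ n.+1 = D / 2.
      by rewrite /D exprS invfM mulrCA mulrC.
    rewrite -rr//.
    (* Newton's iteration for the square root: the new error is the square of the old one over 2 a,
       hence at most half of it, as 0 <= a - r <= a. *)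
    have -> : 2^-1 * (a t + r t * r t / a t) = r t + (a t - r t) ^+ 2 / (2 * a t).
      by field; lra.
    rewrite lerDl lerD2l divr_ge0 ?sqr_ge0 ?mulr_ge0 ?(ltW at0)//=.
    rewrite ler_pdivrMr ?mulr_gt0//; nra.
(* A uniform positive lower bound for the root turns the additive error [e * l] into a factor 1 + e
   <= expR e. *)
have [l l0 lr] : exists2 l, 0 < l & forall t, K t -> l <= r t.
  exists (Num.sqrt (lf * lg)); first by rewrite sqrtr_gt0 mulr_gt0.
  move=> t Kt; have /andP[? ?] := hf _ Kt; have /andP[? ?] := hg _ Kt.
  by rewrite ler_sqrt ?(ltW (fg0 _ Kt))// ler_pM// ltW.
apply: (mc_closed mcP) => e e0.
have [n hn] := exists_exp2_le (addr_ge0 (normr_ge0 uf) (normr_ge0 ug)) (mulr_gt0 e0 l0).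
have [a [Pa _ ha]] := step n; exists a => // t Kt.
have /andP[ra ar] := ha _ Kt; have := lr _ Kt; have r0t := r0 _ Kt.
have := expR_ge1Dx e; rewrite -/(r t) => h1 h2; split; first nra.
by apply: (le_trans ar); apply: (@le_trans _ _ (r t + e * l)); [lra|nra].
Qed.

(** Bisection of the exponent: the midpoint belongs to the square root of the product of the two
    endpoint functions. As ln f and ln g are bounded, nearby exponents give log-close functions. *)
Lemma mc_gmean f g p : P f -> P g -> 0 <= p <= 1 ->
  P (fun t => f t `^ (1 - p) * g t `^ p).
Proof.
move=> Pf Pg /andP[p0 p1].
have step n : exists q0 q1, [/\ q0 <= p <= q1, q1 - q0 = 1 / 2 ^+ n,
    P (fun t => f t `^ (1 - q0) * g t `^ q0) &
    P (fun t => f t `^ (1 - q1) * g t `^ q1)].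
  elim: n => [|n [q0 [q1 [/andP[h0 h1] h P0 P1]]]].
    exists 0, 1; split; rewrite ?p0 ?p1//; first by rewrite expr0; lra.
      apply: (mc_eq Pf) => t Kt; have := mc_gt0 Pf Kt.
      by rewrite subr0 powRr0 mulr1 => /ltW/powRr1.
    apply: (mc_eq Pg) => t Kt; have := mc_gt0 Pg Kt.
    by rewrite subrr powRr0 mul1r => /ltW/powRr1.
  pose q := (q0 + q1) / 2.
  have Pq : P (fun t => f t `^ (1 - q) * g t `^ q).
    apply: (mc_eq (mc_sqrt P0 P1)) => t Kt.
    have f0 := mc_gt0 Pf Kt; have g0 := mc_gt0 Pg Kt.
    rewrite !powR_expR// -!expRD -powR12_sqrt ?expR_ge0//.
    by rewrite -expRM; congr expR; rewrite /q; field.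
  have e2 : 1 / 2 ^+ n.+1 = (q1 - q0) / 2.
    by rewrite h exprS invfM !mul1r mulrC.
  case: (leP p q) => pq.
    by exists q0, q; split=> //; [rewrite h0|rewrite e2 /q; lra].
  by exists q, q1; split=> //; [rewrite (ltW pq)|rewrite e2 /q; lra].
have [Cf Cf0 hf] := mc_log_bounded Pf; have [Cg Cg0 hg] := mc_log_bounded Pg.
apply: (mc_closed mcP) => e e0.
have [n hn] := exists_exp2_le (ltW (addr_gt0 Cf0 Cg0)) e0.
have [q0 [q1 [/andP[h0 h1] h P0 _]]] := step n.
exists (fun t => f t `^ (1 - q0) * g t `^ q0) => // t Kt.
have f0 := mc_gt0 Pf Kt; have g0 := mc_gt0 Pg Kt.
have : `|(p - q0) * (ln (g t) - ln (f t))| <= e.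
  apply: le_trans hn; rewrite normrM mulrC.
  apply: ler_pM => //; last by rewrite -div1r -h ger0_norm; lra.
  by apply: (le_trans (ler_normB _ _)); rewrite addrC lerD ?hf ?hg.
rewrite ler_norml => /andP[? ?].
by rewrite !powR_expR// -!expRD !ler_expR; split; lra.
Qed.

Lemma mc_power_mean f g p : P f -> P g -> 0 < p <= 1 ->
  P (fun t => (f t `^ p + g t `^ p) `^ p^-1).
Proof.
move=> Pf Pg /andP[p0 p1].
have pN0 : p != 0 by rewrite gt_eqF.
have [Cf Cf0 hf] := mc_log_bounded Pf; have [Cg Cg0 hg] := mc_log_bounded Pg.
(* [D] bounds g^p / f^p because p <= 1; the Euler iterates never fall below [f], so the same [D]
   serves at every step. *)
pose D := expR (Cf + Cg).
have D0 : 0 < D by exact: expR_gt0.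
have gD t : K t -> g t `^ p <= D * f t `^ p.
  move=> Kt; have f0 := mc_gt0 Pf Kt; have g0 := mc_gt0 Pg Kt.
  rewrite !powR_expR// -expRD ler_expR.
  have := hf _ Kt; have := hg _ Kt; rewrite !ler_norml => /andP[? ?] /andP[? ?].
  by rewrite -lerBlDr -mulrBr; nra.
have euler d j : 0 < d -> exists S, P S /\ forall t, K t ->
    f t `^ p + j%:R * d * g t `^ p / (1 + d * D / p) <= S t `^ p
      <= f t `^ p + j%:R * d * g t `^ p * expR (d * D).
  move=> d0; elim: j => [|j [S [PS hS]]].
    by exists f; split=> // t Kt; rewrite !mul0r !addr0 lexx.
  exists (fun t => S t + d / p * (S t `^ (1 - p) * g t `^ p)); split.
    apply: (mc_add mcP) => //; apply: (mc_scale mcP); first exact: divr_gt0.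
    by apply: mc_gmean => //; lra.
  move=> t Kt; have S0 := mc_gt0 PS Kt; have f0 := mc_gt0 Pf Kt.
  have Y0 : 0 < g t `^ p by rewrite powR_gt0// mc_gt0.
  have /andP[lo hi] := hS _ Kt.
  have e1 : 0 < (1 + d * D / p)^-1.
    by rewrite invr_gt0 addr_gt0// divr_gt0// mulr_gt0.
  have fS : f t `^ p <= S t `^ p.
    by apply: le_trans lo; rewrite lerDl !mulr_ge0// ltW.
  have YD : g t `^ p <= D * S t `^ p.
    by apply: (le_trans (gD _ Kt)); rewrite ler_pM2l.
  have /andP[lo' hi'] := euler_step (introT andP (conj p0 p1)) d0 S0 Y0 YD.
  rewrite -natr1; apply/andP; split; first by apply: le_trans lo'; lra.
  by apply: (le_trans hi'); lra.
apply: (mc_closed mcP) => e e0.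
(* With step length d = 1 / (n + 1), ln (S^p) is off by at most d D / p; the outer power 1/p divides
   this by [p] again. *)
have [n hn] := exists_nat_le (D / (p * p)) e0.
set d := n.+1%:R^-1 : R.
have d0 : 0 < d by rewrite invr_gt0 ltr0n.
have [S [PS hS]] := euler d n.+1 d0.
exists S => // t Kt; have S0 := mc_gt0 PS Kt.
have f0 := mc_gt0 Pf Kt; have g0 := mc_gt0 Pg Kt.
have fp0 : 0 < f t `^ p by rewrite powR_gt0.
have gp0 : 0 < g t `^ p by rewrite powR_gt0.
set Z := f t `^ p + g t `^ p.
have Z0 : 0 < Z by rewrite addr_gt0.
pose c := d * D / p.
have c0 : 0 < c by rewrite divr_gt0// mulr_gt0.
have /andP[] := hS _ Kt.
rewrite mulfV ?pnatr_eq0// mul1r -/c => lo hi.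
have cE : c / p <= e.
  apply: le_trans hn; rewrite le_eqVlt /c /d -!mulrA invfM.
  by apply/orP; left; apply/eqP; ring.
have Sp0 : 0 < S t `^ p by rewrite powR_gt0.
have close : `|ln Z - ln (S t `^ p)| <= c.
  rewrite ler_norml; apply/andP; split.
    rewrite lerBrDr addrC lerBlDr -[c]expRK -lnM ?posrE ?expR_gt0//.
    rewrite ler_ln ?posrE ?mulr_gt0 ?expR_gt0//.
    apply: (le_trans hi); rewrite /Z mulrDl; apply: lerD.
      by rewrite ler_peMr ?(ltW fp0)// ltW// expR_gt1.
    rewrite ler_pM2l// ler_expR /c ler_pdivlMr//.
    by rewrite ler_piMr// mulr_ge0// ltW.
  rewrite lerBlDr -[c]expRK -lnM ?posrE ?expR_gt0// ler_ln ?posrE ?mulr_gt0 ?expR_gt0//.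
  apply: (@le_trans _ _ ((1 + c) * S t `^ p)); last first.
    by rewrite ler_pM2r// expR_ge1Dx.
  rewrite mulrC -ler_pdivrMr; last by lra.
  apply: le_trans lo; rewrite /Z mulrDl lerD2r ler_pdivrMr; last by lra.
  by rewrite ler_peMr ?(ltW fp0)//; lra.
have SE : S t = (S t `^ p) `^ p^-1 by rewrite powRK.
rewrite SE /= -/Z (powR_expR _ Z0) (powR_expR _ Sp0) -!expRD !ler_expR.
have : `|p^-1 * ln Z - p^-1 * ln (S t `^ p)| <= e.
  rewrite -mulrBr normrM (ger0_norm (ltW _)) ?invr_gt0//.
  by apply: le_trans cE; rewrite mulrC ler_pM2r ?invr_gt0.
rewrite ler_norml => /andP[? ?]; split; lra.
Qed.

End mean_class.

(** * Quotients of power differences and their Riemann sums *)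

Section stolarsky.
Context {R : realType}.
Implicit Types (a b q u v w x e : R).

(** The value at 1 is the limit there. For distinct positive [a], [b], dividing by a / b and taking
    the power 1 / (a - b) gives the Stolarsky mean of [x] and 1. *)
Definition stolarsky a b x : R :=
  if x == 1 then a / b else (x `^ a - 1) / (x `^ b - 1).

Lemma powR_neq1 x a : 0 < x -> x != 1 -> a != 0 -> x `^ a - 1 != 0.
Proof.
by move=> x0 x1 a0; rewrite subr_eq0 powR_eq1 negb_or x1 negb_or -leNgt ltW//= a0.
Qed.

(** Bernoulli's inequality at w / v, multiplied by v^q: a convex power lies above its tangents. *)
Lemma tangent_powR v w q : 0 < v -> 0 < w -> 1 < q ->
  q * v `^ (q - 1) * (w - v) <= w `^ q - v `^ q.
Proof.
move=> v0 w0 q1; have := bernoulli_powR (ltW (divr_gt0 w0 v0)) q1.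
have vq0 : 0 < v `^ q by rewrite powR_gt0.
move/(ler_wpM2l (ltW vq0)); rewrite -powRM ?(ltW v0) ?divr_ge0 ?(ltW v0) ?(ltW w0)//.
rewrite mulrCA divff ?gt_eqF// mulr1.
have -> : v `^ q = v * v `^ (q - 1) by rewrite mulr_powRB1 ?ltW//; lra.
rewrite lerBrDl; apply: le_trans.
rewrite le_eqVlt; apply/orP; left; apply/eqP; field; rewrite lt0r_neq0//.
Qed.

(** The secant slope lies between the tangent slopes at [v] and [w], whose ratio (w / v)^(q - 1) is
    within a factor expR ((q - 1) e) of 1. *)
Lemma secant_powR v w q e : 0 < v -> 0 < w -> v != w -> 1 < q ->
  `|ln w - ln v| <= e ->
  (w `^ q - v `^ q) / (w - v) <= expR ((q - 1) * e) * (q * v `^ (q - 1)) /\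
  q * v `^ (q - 1) <= expR ((q - 1) * e) * ((w `^ q - v `^ q) / (w - v)).
Proof.
move=> v0 w0 vw q1; rewrite ler_norml => /andP[e1 e2].
have e0 : 0 <= e by lra.
have qe0 : 0 <= (q - 1) * e by rewrite mulr_ge0; lra.
have h1 := tangent_powR v0 w0 q1; have h2 := tangent_powR w0 v0 q1.
have vq0 : 0 < q * v `^ (q - 1) by rewrite mulr_gt0 ?powR_gt0; lra.
have wq0 : 0 < q * w `^ (q - 1) by rewrite mulr_gt0 ?powR_gt0; lra.
have E1 : 1 <= expR ((q - 1) * e) by have := expR_ge1Dx ((q - 1) * e); lra.
have wv : q * w `^ (q - 1) <= expR ((q - 1) * e) * (q * v `^ (q - 1)).
  rewrite mulrCA ler_pM2l; last by lra.
  by rewrite !powR_expR// -expRD ler_expR; nra.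
have vw' : q * v `^ (q - 1) <= expR ((q - 1) * e) * (q * w `^ (q - 1)).
  rewrite mulrCA ler_pM2l; last by lra.
  by rewrite !powR_expR// -expRD ler_expR; nra.
set A := q * v `^ (q - 1) in h1 vq0 wv vw' *.
set B := q * w `^ (q - 1) in h2 wq0 wv vw'.
set Z := _ / _.
have ZE : w `^ q - v `^ q = Z * (w - v) by rewrite divfK// subr_eq0 eq_sym.
move: vw; rewrite neq_lt => /orP[vw|vw].
  have AZ : A <= Z by rewrite -(@ler_pM2r _ (w - v)) ?subr_gt0//; lra.
  have ZB : Z <= B by rewrite -(@ler_pM2r _ (w - v)) ?subr_gt0//; lra.
  split; first exact: le_trans wv.
  by apply: (le_trans AZ); rewrite ler_peMl//; lra.
have AZ : Z <= A by rewrite -(@ler_pM2r _ (v - w)) ?subr_gt0//; lra.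
have ZB : B <= Z by rewrite -(@ler_pM2r _ (v - w)) ?subr_gt0//; lra.
split; first by apply: (le_trans AZ); rewrite ler_peMl// ltW.
by apply: (le_trans vw'); rewrite ler_wpM2l ?expR_ge0.
Qed.

Lemma ln_lipschitz m v w : 0 < m -> m <= v -> m <= w ->
  `|ln w - ln v| <= `|w - v| / m.
Proof.
move=> m0; wlog vw : v w / v <= w.
  move=> H mv mw; case: (leP v w) => [/H|/ltW/H]; first exact.
  by rewrite distrC (distrC w) => ->.
move=> mv mw; have v0 : 0 < v by exact: lt_le_trans mv.
have w0 : 0 < w by exact: lt_le_trans mw.
rewrite !ger0_norm ?subr_ge0// ?ler_ln ?posrE//.
rewrite -ln_div ?posrE//; apply: (@le_trans _ _ ((w - v) / v)).
  have -> : w / v = 1 + (w - v) / v by field; lra.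
  by apply: le_ln1Dx; apply: (@lt_le_trans _ _ 0); rewrite ?divr_ge0// ?subr_ge0// ltW.
by rewrite ler_wpM2l ?subr_ge0// lef_pV2.
Qed.

(* Riemann sum, in the variable v = 1 + s (x^b - 1), of
   (x^a - 1) / (x^b - 1) = (a/b) \int_0^1 v^(a/b - 1) ds. *)
Lemma stolarsky_riemann a b x C n : 0 < b <= 1 -> b < a -> 0 < x -> `|ln x| <= C ->
  let E := expR ((a / b - 1) * (expR (2 * C) / n.+1%:R)) in
  let S := \sum_(j < n.+1) a / b / n.+1%:R *
             (1 + j%:R / n.+1%:R * (x `^ b - 1)) `^ (a / b - 1) in
  stolarsky a b x <= E * S /\ S <= E * stolarsky a b x.
Proof.
move=> /andP[b0 b1] ab x0 xC E S.
have q1 : 1 < a / b by rewrite ltr_pdivlMr// mul1r.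
have N0 : 0 < n.+1%:R :> R by rewrite ltr0n.
set q := a / b in q1 E S *; set N := n.+1%:R in N0 E S *.
have E1 : 1 <= E.
  apply: le_trans (expR_ge1Dx _); rewrite lerDl.
  by rewrite mulr_ge0 ?divr_ge0 ?expR_ge0 ?(ltW N0)//; lra.
rewrite /stolarsky; case: eqVneq => [x1|x1].
  have -> : S = q.
    rewrite /S x1 powR1 (eq_bigr (fun=> q / N)); last first.
      by move=> j _; rewrite subrr mulr0 addr0 powR1 mulr1.
    rewrite sumr_const card_ord -mulr_natr divfK// gt_eqF//.
  by rewrite -/q; split; rewrite ler_peMl//; lra.
set u := x `^ b in S *.
have u0 : 0 < u by exact: powR_gt0.
have u1 : u - 1 != 0 by apply: powR_neq1 => //; exact: lt0r_neq0.
pose v (j : nat) := 1 + j%:R / N * (u - 1).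
have v_step j : v j.+1 - v j = (u - 1) / N.
  by rewrite /v -natr1; field; exact: lt0r_neq0.
have C0 : 0 <= C by apply: le_trans xC.
have uC : expR (- C) <= u <= expR C.
  rewrite /u powR_expR// !ler_expR; move: xC; rewrite ler_norml => /andP[? ?].
  by apply/andP; split; nra.
have eC1 : expR (- C) <= 1 by rewrite expR_le1; lra.
(* [v j] is a convex combination of 1 and [u], both at least expR (- C). *)
have v_ge j : (j <= n.+1)%N -> expR (- C) <= v j.
  move=> jn; have jN : 0 <= j%:R / N <= 1.
    by rewrite divr_ge0//= ler_pdivrMr// mul1r ler_nat.
  by rewrite /v; set s := j%:R / N in jN *; move/andP: jN => [? ?]; nra.
have v0 j : (j <= n.+1)%N -> 0 < v j.
  by move=> /v_ge; apply: lt_le_trans; exact: expR_gt0.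
(* Since u - 1 = N (v j.+1 - v j), [Tj] is 1/N times a secant slope of the q-th power, while the
   Riemann summand is 1/N times its tangent slope at [v j]. *)
have term (j : 'I_n.+1) : let Tj := (v j.+1 `^ q - v j `^ q) / (u - 1) in
    Tj <= E * (q / N * v j `^ (q - 1)) /\ q / N * v j `^ (q - 1) <= E * Tj.
  move=> Tj; have jn : (j <= n.+1)%N by rewrite ltnW.
  have vv : v j != v j.+1.
    by rewrite eq_sym -subr_eq0 v_step mulf_neq0// invr_eq0 lt0r_neq0.
  have lnv : `|ln (v j.+1) - ln (v j)| <= expR (2 * C) / N.
    apply: (le_trans (ln_lipschitz (expR_gt0 (- C)) (v_ge _ jn) (v_ge j.+1 (ltn_ord j)))).
    rewrite v_step expRN invrK normrM normfV (ger0_norm (ltW N0)) mulrAC.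
    rewrite ler_pM2r ?invr_gt0// mulrDl mul1r expRD ler_pM2r ?expR_gt0//.
    rewrite ler_norml; move/andP: uC => [? ?]; apply/andP; split; last by lra.
    have : 1 <= expR C by have := expR_ge1Dx C; lra.
    lra.
  have [h1 h2] := secant_powR (v0 _ jn) (v0 j.+1 (ltn_ord j)) vv q1 lnv.
  have TE : Tj = (v j.+1 `^ q - v j `^ q) / (v j.+1 - v j) / N.
    by rewrite /Tj v_step; field; rewrite u1 lt0r_neq0.
  rewrite TE; split.
    have -> : E * (q / N * v j `^ (q - 1)) = E * (q * v j `^ (q - 1)) / N by ring.
    by rewrite ler_pM2r ?invr_gt0.
  have -> : q / N * v j `^ (q - 1) = q * v j `^ (q - 1) / N by ring.
  by rewrite mulrA ler_pM2r ?invr_gt0.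
have -> : (x `^ a - 1) / (u - 1) = \sum_(j < n.+1) (v j.+1 `^ q - v j `^ q) / (u - 1).
  rewrite -mulr_suml -(big_mkord xpredT (fun j => v j.+1 `^ q - v j `^ q)).
  rewrite telescope_sumr//.
  have -> : v n.+1 = u by rewrite /v divff ?lt0r_neq0//; lra.
  have -> : v 0%N = 1 by rewrite /v mul0r mul0r addr0.
  by rewrite powR1 /u -powRrM /q mulrCA divff ?mulr1// lt0r_neq0.
by rewrite /S !mulr_sumr; split; apply: ler_sum => j _; case: (term j).
Qed.

End stolarsky.

(** * Roots of these quotients belong to mean classes *)

Section mean_class_stolarsky.
Context {R : realType} {T : Type} {K : set T} {P : (T -> R) -> Prop}.
Hypothesis mcP : mean_class K P.
Implicit Types (f g x : T -> R) (t : T) (a b c p : R).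

Lemma mc_sum_power n (k : nat -> T -> R) c p : (forall j, P (k j)) ->
  0 < c -> 0 < p <= 1 ->
  P (fun t => (\sum_(j < n.+1) c * k j t `^ p) `^ p^-1).
Proof.
move=> Pk c0 p01; have /andP[p0 p1] := p01; have pN0 : p != 0 by rewrite gt_eqF.
have Pck j : P (fun t => c `^ p^-1 * k j t).
  by apply: (mc_scale mcP) => //; exact: powR_gt0.
have ckE j t : K t -> (c `^ p^-1 * k j t) `^ p = c * k j t `^ p.
  by move=> /(mc_gt0 mcP (Pk j)) k0; rewrite powRM ?powR_ge0 ?(ltW k0)// powRKV.
elim: n => [|n IHn].
  apply: (mc_eq mcP (Pck 0%N)) => t Kt.
  rewrite big_ord1 /= -ckE// powRK//.
  by rewrite mulr_gt0 ?powR_gt0// (mc_gt0 mcP (Pk 0%N)).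
apply: (mc_eq mcP (mc_power_mean mcP IHn (Pck n.+1) p01)) => t Kt.
 rewrite ckE// powRKV// ?big_ord_recr//=.
rewrite ltr_wpDl ?sumr_ge0//; first by move=> j _; rewrite mulr_ge0 ?powR_ge0// ltW.
by rewrite mulr_gt0// powR_gt0// (mc_gt0 mcP (Pk _)).
Qed.

(** This is the power mean with exponent [b] of (1 - s)^(1/b) and s^(1/b) x. The case s = 0 is
    separate because the second function would vanish. *)
Lemma mc_affine_power x b s : P x -> 0 < b <= 1 -> 0 <= s < 1 ->
  P (fun t => (1 + s * (x t `^ b - 1)) `^ b^-1).
Proof.
move=> Px b01; have /andP[b0 b1] := b01.
move=> /andP[]; rewrite le_eqVlt => /predU1P[<-|s0] s1.
  apply: (mc_eq mcP (mc_one mcP)) => t Kt.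
  by rewrite mul0r addr0 powR1.
have s1' : 0 < 1 - s by lra.
have bN0 : b != 0 by rewrite gt_eqF.
have P1 : P (fun t => (1 - s) `^ b^-1 * 1).
  by apply: (mc_scale mcP); [exact: powR_gt0|exact: mc_one mcP].
have P2 : P (fun t => s `^ b^-1 * x t).
  by apply: (mc_scale mcP) => //; exact: powR_gt0.
apply: (mc_eq mcP (mc_power_mean mcP P1 P2 b01)) => t Kt.
 have x0 := mc_gt0 mcP Px Kt.
by rewrite mulr1 powRM ?powR_ge0 ?(ltW x0)// !powRKV//; congr (_ `^ _); ring.
Qed.

(** Since v^(a/b - 1) = (v^(1/b))^(a - b), the Riemann sum raised to 1 / (a - b) is a weighted power
    mean, with exponent a - b, of members of the class. *)
Lemma mc_stolarsky x a b : P x -> 0 < b <= 1 -> b < a -> a - b <= 1 ->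
  P (fun t => stolarsky a b (x t) `^ (a - b)^-1).
Proof.
move=> Px b01 ab p1; have /andP[b0 b1] := b01.
have p0 : 0 < a - b by lra.
have pN0 : a - b != 0 by rewrite gt_eqF.
have q1 : 1 < a / b by rewrite ltr_pdivlMr// mul1r.
have [C C0 hC] := mc_log_bounded mcP Px.
apply: (mc_closed mcP) => e e0.
have [n hn] := exists_nat_le ((a - b)^-1 * ((a / b - 1) * expR (2 * C))) e0.
(* [mc_sum_power] takes an infinite sequence; truncating the index at [n] keeps s j < 1 throughout
   and leaves the terms of the sum unchanged. *)
pose s (j : nat) : R := (minn j n)%:R / n.+1%:R.
pose k j t := (1 + s j * (x t `^ b - 1)) `^ b^-1.
have Pk j : P (k j).
  apply: mc_affine_power => //; rewrite /s divr_ge0//= ltr_pdivrMr ?ltr0n// mul1r.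
  by rewrite ltr_nat ltnS geq_minr.
have c0 : 0 < a / b / n.+1%:R.
  by rewrite divr_gt0 ?ltr0n//; lra.
exists (fun t => (\sum_(j < n.+1) a / b / n.+1%:R * k j t `^ (a - b)) `^ (a - b)^-1).
  by apply: mc_sum_power => //; rewrite p0.
move=> t Kt; have x0 := mc_gt0 mcP Px Kt.
have [h1 h2] := stolarsky_riemann n b01 ab x0 (hC _ Kt).
set E := expR _ in h1 h2.
have -> : \sum_(j < n.+1) a / b / n.+1%:R * k j t `^ (a - b) =
    \sum_(j < n.+1) a / b / n.+1%:R *
      (1 + j%:R / n.+1%:R * (x t `^ b - 1)) `^ (a / b - 1).
  apply: eq_bigr => j _; congr (_ * _); rewrite /k /s.
  have jn : (j <= n)%N by rewrite -ltnS.
  have e1 : b^-1 * (a - b) = a / b - 1 by field; exact: lt0r_neq0.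
  by rewrite (minn_idPl jn) -powRrM e1.
set S := \sum_(j < _) _ in h1 h2 *.
have S0 : 0 < S.
  rewrite /S big_ord_recl /= ltr_pwDl//.
    by rewrite mul0r mul0r addr0 powR1 mulr1.
  by apply: sumr_ge0 => j _; rewrite mulr_ge0 ?powR_ge0// ltW.
have E0 : 0 < E by exact: expR_gt0.
have st0 : 0 < stolarsky a b (x t).
  by rewrite -(pmulr_rgt0 _ E0); exact: lt_le_trans h2.
have powE y : 0 < y -> (E * y) `^ (a - b)^-1 <= expR e * y `^ (a - b)^-1.
  move=> y0; rewrite powRM ?(ltW E0) ?(ltW y0)// ler_pM2r ?powR_gt0//.
  rewrite -expRM ler_expR; apply: le_trans hn.
  by rewrite mulrC !mulrA.
have pV0 : 0 <= (a - b)^-1 by rewrite invr_ge0 ltW.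
split.
  apply: le_trans (powE S S0); apply: ge0_ler_powR => //; rewrite nnegrE.
    exact: ltW.
  by rewrite mulr_ge0// ltW.
apply: le_trans (powE _ st0); apply: ge0_ler_powR => //; rewrite nnegrE.
  exact: ltW.
by rewrite mulr_ge0// ltW.
Qed.

End mean_class_stolarsky.

(** Inversion exchanges sums with parallel sums and preserves log-closeness. This supplies the
    duality f |-> 1/f(1/t). *)
Lemma mean_class_inv {R : realType} {T : Type} {K : set T} {P : (T -> R) -> Prop} :
  mean_class K P -> mean_class K (fun f => P (fun t => (f t)^-1)).
Proof.
move=> mcP; split.
- move=> f Pf; have [l [u [l0 h]]] := mc_bounded mcP Pf.
  (* The upper bound [u] is known to be positive only once [K] has a point. *)
  have [[t Kt]|noK] := pselect (exists t, K t); last first.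
    by exists 1, 1; split=> // t Kt; case: noK; exists t.
  have u0 : 0 < u by have /andP[h1 h2] := h _ Kt; exact: lt_le_trans l0 (le_trans h1 h2).
  exists u^-1, l^-1; split; first by rewrite invr_gt0.
  move=> {Kt}t /[dup] Kt /h/andP[lf fu].
  have f0 : 0 < (f t)^-1 by exact: lt_le_trans lf.
  by rewrite -[f t]invrK !lef_pV2 ?posrE// lf fu.
- by apply: (mc_eq mcP (mc_one mcP)) => t _; rewrite invr1.
- move=> c f c0 Pf; have cV0 : 0 < c^-1 by rewrite invr_gt0.
  by apply: (mc_eq mcP (mc_scale mcP cV0 Pf)) => t _; rewrite invfM.
- move=> f g Pf Pg; apply: (mc_eq mcP (mc_par mcP Pf Pg)) => t _.
  by rewrite !invrK.
- move=> f g Pf Pg; apply: (mc_eq mcP (mc_add mcP Pf Pg)) => t _.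
  by rewrite invrK.
- move=> f hf; apply: (mc_closed mcP) => e e0; have [g Pg fg] := hf e e0.
  exists (fun t => (g t)^-1) => // t Kt; have [h1 h2] := fg t Kt.
  have g0 : 0 < g t by rewrite -invr_gt0 (mc_gt0 mcP Pg).
  have f0 : 0 < f t by rewrite -(pmulr_rgt0 _ (expR_gt0 e)); exact: lt_le_trans h2.
  by split; rewrite ler_pdivlMr// mulrC ler_pdivrMr.
Qed.

(** * Powers of members of a mean class *)

Section power_class.
Context {R : realType} {T : Type} (K : set T) (P : (T -> R) -> Prop).
Hypothesis mcP : mean_class K P.
Implicit Types (f g x : T -> R) (t : T) (a b c d : R).

(* The analogue of: 0 <= arg f(z) <= c arg z on the upper half-plane. *)
Definition power_class c f :=
  0 <= c /\ exists2 g, P g & forall t, K t -> f t = g t `^ c.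

Lemma power_class_eq c f g :
  power_class c f -> (forall t, K t -> g t = f t) -> power_class c g.
Proof.
by move=> [c0 [h Ph fh]] gf; split=> //; exists h => // t Kt; rewrite gf ?fh.
Qed.

Lemma power_class1 : power_class 0 (fun=> 1).
Proof.
by split=> //; exists (fun=> 1); [exact: mc_one mcP|move=> t _; rewrite powR1].
Qed.

(** f'^c g'^d is the (c + d)-th power of the geometric mean of [f'] and [g'] with weight d / (c +
    d). *)
Lemma power_classM c d f g : power_class c f -> power_class d g ->
  power_class (c + d) (fun t => f t * g t).
Proof.
move=> [c0 [f' Pf fE]] [d0 [g' Pg gE]]; split; first exact: addr_ge0.
have [cd|cd] := eqVneq (c + d) 0.
  have c_eq0 : c = 0 by lra.
  have d_eq0 : d = 0 by lra.
  exists (fun=> 1); first exact: mc_one mcP.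
  by move=> t Kt; rewrite fE// gE// c_eq0 d_eq0 !powRr0 powR1 mulr1.
have cd0 : 0 < c + d by rewrite lt0r cd addr_ge0.
have p01 : 0 <= d / (c + d) <= 1.
  by rewrite divr_ge0 ?(ltW cd0)//= ler_pdivrMr// mul1r lerDr.
exists (fun t => f' t `^ (1 - d / (c + d)) * g' t `^ (d / (c + d))).
  exact: (mc_gmean mcP).
move=> t Kt; rewrite fE// gE// powRM ?powR_ge0// -!powRrM.
by congr (_ `^ _ * _ `^ _); field.
Qed.

Lemma power_class_prod n (c : 'I_n -> R) (f : 'I_n -> T -> R) :
  (forall i, power_class (c i) (f i)) ->
  power_class (\sum_i c i) (fun t => \prod_i f i t).
Proof.
elim: n c f => [|n IHn] c f hf.
  by rewrite big_ord0; apply: (power_class_eq power_class1) => t _; rewrite big_ord0.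
rewrite big_ord_recl.
apply: (power_class_eq (power_classM (hf ord0) (IHn _ _ (fun i => hf (lift ord0 i))))).
by move=> t _; rewrite big_ord_recl.
Qed.

(** For 0 <= c <= 1, g^c is the geometric mean of 1 and [g] with weight [c]. *)
Lemma power_class_mc c f : power_class c f -> c <= 1 -> P f.
Proof.
move=> [c0 [g Pg fg]] c1.
apply: (mc_eq mcP (mc_gmean mcP (mc_one mcP) Pg (introT andP (conj c0 c1)))) => t Kt.
by rewrite powR1 mul1r fg.
Qed.

Lemma power_class_powR x c : P x -> 0 <= c -> power_class c (fun t => x t `^ c).
Proof. by move=> Px c0; split=> //; exists x. Qed.

Lemma stolarsky_gt0 a b (y : R) : 0 < a -> 0 < b -> 0 < y -> 0 < stolarsky a b y.
Proof.
move=> a0 b0 y0; rewrite /stolarsky; case: eqVneq => [_|y1]; first exact: divr_gt0.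
have sgn c : 0 < c -> (0 < y `^ c - 1) = (1 < y).
  move=> c0; rewrite subr_gt0 powR_expR// expR_gt1 pmulr_rgt0//.
  have [y_gt1|y_le1] := ltP 1 y; first exact: ln_gt0.
  by rewrite ltNge ln_le0.
have [y_gt1|y_le1] := ltP 1 y; first by rewrite divr_gt0// sgn.
have neg c : 0 < c -> 0 < - (y `^ c - 1).
  by move=> c0; rewrite oppr_gt0 lt_neqAle leNgt sgn// -leNgt y_le1 powR_neq1// gt_eqF.
by rewrite -mulrNN -invrN divr_gt0// neg.
Qed.

Lemma power_class_stolarsky x a b : P x -> 0 < b <= 1 -> b < a -> a - b <= 1 ->
  power_class (a - b) (fun t => stolarsky a b (x t)).
Proof.
move=> Px /[dup] b01 /andP[b0 b1] ab p1; split; first by rewrite subr_ge0 ltW.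
exists (fun t => stolarsky a b (x t) `^ (a - b)^-1); first exact: (mc_stolarsky mcP).
move=> t /(mc_gt0 mcP Px) x0.
have pN0 : a - b != 0 by rewrite subr_eq0 gt_eqF.
by rewrite powRKV// stolarsky_gt0// (lt_trans b0).
Qed.

End power_class.

(** Apply x^(-c) - 1 = - x^(-c) (x^c - 1) to numerator and denominator. *)
Lemma stolarsky_inv {R : realType} (a b x : R) : 0 < x ->
  (stolarsky a b x^-1)^-1 = x `^ (a - b) * stolarsky b a x.
Proof.
move=> x0; rewrite /stolarsky invr_eq1; case: eqVneq => [->|x1].
  by rewrite powR1 mul1r invf_div.
rewrite invf_div !powRVl// powRD_gt0// powRN.
have xa0 : x `^ a != 0 by rewrite gt_eqF ?powR_gt0.
have xb0 : x `^ b != 0 by rewrite gt_eqF ?powR_gt0.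
have -> : (x `^ b)^-1 - 1 = - (x `^ b)^-1 * (x `^ b - 1) by field.
have -> : (x `^ a)^-1 - 1 = - (x `^ a)^-1 * (x `^ a - 1) by field.
by rewrite invfM invrN invrK; ring.
Qed.

(** * The factor of one pair of exponents, and the whole product *)

Section pairs.
Context {R : realType} {T : Type} {K : set T} {P : (T -> R) -> Prop}.
Hypothesis mcP : mean_class K P.
Implicit Types (x : T -> R) (t : T) (a b : R).

(** The case of a larger first exponent is applied in the inverted class, which contains 1/x, and
    the result is inverted back. *)
Lemma power_class_stolarsky_dual x a b : P x -> 0 < a <= 1 -> a < b -> b - a <= 1 ->
  power_class K P (b - a) (fun t => x t `^ (b - a) * stolarsky a b (x t)).
Proof.
move=> Px a01 ab p1.
have Px' : P (fun t => (x t)^-1^-1).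
  by apply: (mc_eq mcP Px) => t _; rewrite invrK.
have [c0 [g Pg gE]] := power_class_stolarsky (mean_class_inv mcP) Px' a01 ab p1.
split=> //; exists (fun t => (g t)^-1) => // t Kt.
have g0 := mc_gt0 mcP Pg Kt.
rewrite -stolarsky_inv ?(mc_gt0 mcP Px Kt)// gE// -powRVl//.
by rewrite -[g t]invrK invr_gt0.
Qed.

Lemma stolarsky_mul a b c (y : R) : c != 0 -> 0 < y ->
  stolarsky a c y * stolarsky c b y = stolarsky a b y.
Proof.
move=> c0 y0; rewrite /stolarsky; case: eqVneq => [_|y1].
  by rewrite mulrA divfK.
by rewrite mulrA divfK// powR_neq1.
Qed.

Lemma power_class_pair x a b : P x -> 0 < a <= 2 -> 0 < b <= 2 -> a != b ->
  F a b + F b a <= 1 ->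
  power_class K P (F a b + F b a) (fun t => x t `^ F b a * stolarsky a b (x t)).
Proof.
move=> Px /andP[a0 a2] /andP[b0 b2] ab.
case: (leP b 1) => [b1|b1]; [|case: (leP a 1) => [a1|a1]].
- have [ba|ba] := ltP b a.
    have -> : F a b = a - b by rewrite /F (ltW ba) (ltW b0) b1.
    have -> : F b a = 0 by rewrite /F [a <= b]leNgt ba /= [1 < b]ltNge b1.
    rewrite addr0 => p1.
    have h := power_class_stolarsky mcP Px (introT andP (conj b0 b1)) ba p1.
    by apply: (power_class_eq h) => t _; rewrite powRr0 mul1r.
  have {ba} ab' : a < b by rewrite lt_neqAle ab.
  have a1 : a <= 1 by lra.
  have -> : F b a = b - a by rewrite /F (ltW ab') (ltW a0) a1.
  have -> : F a b = 0 by rewrite /F [b <= a]leNgt ab' /= [1 < a]ltNge a1.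
  by rewrite add0r => p1; apply: power_class_stolarsky_dual => //; rewrite a0.
- have ab' : a < b by lra.
  have -> : F b a = b - a by rewrite /F (ltW ab') (ltW a0) a1.
  have -> : F a b = 0 by rewrite /F [b <= a]leNgt ab' /= [1 < a]ltNge a1.
  by rewrite add0r => p1; apply: power_class_stolarsky_dual => //; rewrite a0.
(* Both exponents exceed 1, so 1 is inserted between them: the pairs (a, 1) and (1, b) contribute
   the class exponents a - 1 and b - 1. *)
- have -> : F a b = a - 1 by rewrite /F [b <= 1]leNgt b1 /= !andbF a1 a2 b2.
  have -> : F b a = b - 1 by rewrite /F [a <= 1]leNgt a1 /= !andbF b1 a2 b2.
  move=> p1; have c1 : 0 < (1 : R) <= 1 by rewrite ltr01 lexx.
  have h1 := power_class_stolarsky mcP Px c1 a1 ltac:(lra).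
  have h2 := power_class_stolarsky_dual Px c1 b1 ltac:(lra).
  apply: (power_class_eq (power_classM mcP h1 h2)) => t Kt.
  have x0 := mc_gt0 mcP Px Kt.
  by rewrite mulrCA stolarsky_mul.
Qed.

Lemma F_ge0 a b : 0 < a -> 0 < b -> 0 <= F a b.
Proof.
move=> a0 b0; rewrite /F; case: ifP => [/andP[ba _]|_]; first by rewrite subr_ge0.
by case: ifP => // /andP[/andP[a1 _] _]; rewrite subr_ge0 ltW.
Qed.

Lemma mc_stolarsky_prod x n (gamma : R) (alpha beta : 'I_n -> R) : P x ->
  (forall i, 0 < alpha i <= 2) -> (forall i, 0 < beta i <= 2) ->
  (forall i, alpha i != beta i) ->
  0 <= gamma - \sum_i F (beta i) (alpha i) ->
  gamma + \sum_i F (alpha i) (beta i) <= 1 ->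
  P (fun t => x t `^ gamma * \prod_i stolarsky (alpha i) (beta i) (x t)).
Proof.
move=> Px ha hb hab hlow hupp.
pose c i := F (alpha i) (beta i) + F (beta i) (alpha i).
have a0 i : 0 < alpha i by case/andP: (ha i).
have b0 i : 0 < beta i by case/andP: (hb i).
have c0 i : 0 <= c i by rewrite addr_ge0 ?F_ge0.
have cE : \sum_i c i = \sum_i F (alpha i) (beta i) + \sum_i F (beta i) (alpha i).
  by rewrite big_split.
(* The two hypotheses on [gamma] add up to a bound 1 for the sum of the nonnegative [c i]. *)
have c1 i : c i <= 1.
  have : c i <= \sum_i c i by rewrite (bigD1 i)//= lerDl sumr_ge0.
  lra.
have hprod := power_class_prod mcP (fun i => power_class_pair Px (ha i) (hb i) (hab i) (c1 i)).
have hall := power_classM mcP (power_class_powR K Px hlow) hprod.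
apply: (power_class_mc mcP (power_class_eq hall _)); last by rewrite -/c; lra.
move=> t Kt; have x0 := mc_gt0 mcP Px Kt.
rewrite big_split /= mulrA; congr (_ * _).
have -> : \prod_i x t `^ F (beta i) (alpha i) = x t `^ (\sum_i F (beta i) (alpha i)).
  rewrite powR_expR// mulr_suml expR_sum; apply: eq_bigr => i _.
  by rewrite powR_expR.
by rewrite -powRD_gt0// subrK.
Qed.

End pairs.
(** * The functional calculus *)

Section continuity.
Context {R : realType} {U : topologicalType}.
Implicit Types h k : U -> R.

(** The domain is an arbitrary topological space, so that subspace topologies, and with them
    continuity within a set, are covered. *)
Lemma continuous_mul h k :
  continuous h -> continuous k -> continuous (fun t => h t * k t).
Proof. by move=> hc kc t; exact: (cvgM (hc t) (kc t)). Qed.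

Lemma continuous_add h k :
  continuous h -> continuous k -> continuous (fun t => h t + k t).
Proof. by move=> hc kc t; exact: (cvgD (hc t) (kc t)). Qed.

Lemma continuous_scale c h : continuous h -> continuous (fun t => c * h t).
Proof. by apply: continuous_mul => t; exact: cvg_cst. Qed.

(** Differences are written with [-1 *] so that [fc_add] and [fc_scale] apply to them literally. *)
Lemma continuous_sub h k :
  continuous h -> continuous k -> continuous (fun t => h t + -1 * k t).
Proof. by move=> hc kc; apply: continuous_add => //; exact: continuous_scale. Qed.

Lemma continuous_sqrt h : continuous h -> continuous (fun t => Num.sqrt (h t)).
Proof.
by move=> hc t; apply: (@continuous_comp U R R); [exact: hc|exact: sqrt_continuous].
Qed.

End continuity.

Section functional_calculus.
Context {R : realType} {H : hilbertSpace R}.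
Implicit Types (A B X Y : boundedOp H) (x y v : H).

Lemma op_leE X Y : op_le X Y <-> forall x, inner H (X x) x <= inner H (Y x) x.
Proof. by split=> h x; have := h x; rewrite linearBl subr_ge0. Qed.

Lemma boundedOp_bound X : exists2 c : R, 0 < c & forall x, `|X x| <= c%:C * `|x|.
Proof.
have : bounded_near X (nbhs (0 : H)).
  by apply/linear_bounded_continuous; exact: op_continuous.
move=> /linear_boundedP/pinfty_ex_gt0[r r0 hr].
have [r' rE] : exists r' : R, r = r'%:C :> R[i].
  exists (@complex.Re R r); symmetry; by apply: RRe_real; exact: gtr0_real.
exists r'; first by rewrite -ltcR -rE.
by move=> x; rewrite -rE.
Qed.

(* <X^-1 v, v> is compared with <Y^-1 v, v> by expanding
   0 <= <X (w - u), w - u> at w = X^-1 v, u = Y^-1 v. *)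
Lemma op_le_inv X Y (X' Y' : boundedOp H) :
  positive_op X -> (forall x y, inner H (X x) y = inner H x (X y)) ->
  positive_op Y' -> op_le X Y ->
  (forall x, X (X' x) = x) -> (forall x, Y (Y' x) = x) ->
  op_le Y' X'.
Proof.
move=> Xpos Xsym Y'pos /op_leE XY XX' YY'; apply/op_leE => v.
set w := X' v; set u := Y' v.
have Xw : X w = v by rewrite /w XX'.
have Yu : Y u = v by rewrite /u YY'.
have := Xpos (w - u).
have -> : inner H (X (w - u)) (w - u) =
    inner H v w - inner H v u - (inner H (X u) w - inner H (X u) u).
  by rewrite [X (w - u)]linearB Xw linearBl !linearBr.
have := XY u; rewrite Yu => h.
have uv : inner H (X u) w = inner H u v by rewrite Xsym Xw.
(* Positivity of [Y'] makes <u, v> real, hence equal to its conjugate. *)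
have vu : inner H v u = inner H u v.
  by rewrite [LHS]hermC /= expr0 mul1r; apply: conj_Creal; rewrite ger0_real// Y'pos.
have vw : inner H w v = inner H v w by rewrite -{1}Xw -Xsym Xw.
rewrite vw uv vu => h2; rewrite -subr_ge0; apply: (le_trans h2).
(* The last summand is <Y u, u> - <X u, u>, nonnegative because X <= Y. *)
have e : inner H v w - inner H u v = inner H v w - inner H u v -
    (inner H u v - inner H (X u) u) + (inner H v u - inner H (X u) u).
  by rewrite vu subrK.
by rewrite [leRHS]e lerDl subr_ge0.
Qed.

Section calculus.
Variables (A : boundedOp H) (Phi : (R -> R) -> boundedOp H).
Hypothesis fcPhi : is_functional_calculus A Phi.
Let sp : set R := real_spectrum A.
Implicit Types h k : R -> R.

Lemma fc_sub h k x : {within sp, continuous h} -> {within sp, continuous k} ->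
  Phi (fun t => h t + -1 * k t) x = Phi h x - Phi k x.
Proof.
move=> hc kc; have kc' : {within sp, continuous (fun t => -1 * k t)}.
  exact: continuous_scale.
by rewrite (fc_add fcPhi)// (fc_scale fcPhi)// rmorphN rmorph1 scaleN1r.
Qed.

(** On the spectrum h - k has sup norm 0, so [fc_bounded] annihilates its image. *)
Lemma fc_ext h k x : {within sp, continuous h} -> {within sp, continuous k} ->
  (forall t, sp t -> h t = k t) -> Phi h x = Phi k x.
Proof.
move=> hc kc hk; have [M hM] := fc_bounded fcPhi.
have hk0 t : sp t -> `|h t + -1 * k t| <= 0.
  by move=> /hk ->; rewrite mulN1r subrr normr0.
have := hM _ 0 (continuous_sub hc kc) hk0 x; rewrite fc_sub// mulr0 mul0r.
by rewrite normr_le0 subr_eq0 => /eqP.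
Qed.

(** With r the square root of [h], the form becomes the squared norm of [Phi r x]. *)
Lemma fc_ge0 h x : {within sp, continuous h} -> (forall t, sp t -> 0 <= h t) ->
  0 <= inner H (Phi h x) x.
Proof.
move=> hc h0; pose r t := Num.sqrt (h t).
have rc : {within sp, continuous r}.
  exact: continuous_sqrt.
have rrc : {within sp, continuous (fun t => r t * r t)}.
  exact: continuous_mul.
rewrite (@fc_ext h (fun t => r t * r t))//; last first.
  by move=> t /h0 ht; rewrite -expr2 sqr_sqrtr.
by rewrite (fc_mul fcPhi)// (fc_adjoint fcPhi)// dnorm_ge0.
Qed.

Lemma fc_le h k x : {within sp, continuous h} -> {within sp, continuous k} ->
  (forall t, sp t -> h t <= k t) -> inner H (Phi h x) x <= inner H (Phi k x) x.
Proof.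
move=> hc kc hk; rewrite -subr_ge0 -linearBl -fc_sub//.
by apply: fc_ge0; [exact: continuous_sub|move=> t /hk; rewrite mulN1r subr_ge0].
Qed.

Lemma fc_inner_scale c h x : {within sp, continuous h} ->
  inner H (Phi (fun t => c * h t) x) x = c%:C * inner H (Phi h x) x.
Proof. by move=> hc; rewrite (fc_scale fcPhi)// linearZl_LR. Qed.

Lemma fc_norm h x : {within sp, continuous h} ->
  inner H (Phi h x) (Phi h x) = inner H (Phi (fun t => h t * h t) x) x.
Proof. by move=> hc; rewrite (fc_mul fcPhi)// [RHS](fc_adjoint fcPhi). Qed.

(* With u = t - t0, the function h = 1 - u^2 / max(e^2, u^2) is a bump
   supported in |u| < e, and k = u / max(e^2, u^2) satisfies u k = 1 - h.  If
   Phi h were 0, Phi k would be an inverse of A - t0. *)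
Lemma approx_eigenvector (t0 e : R) : sp t0 -> 0 < e ->
  exists2 x, x != 0 & inner H (A x - t0%:C *: x) (A x - t0%:C *: x)
    <= (e ^+ 2)%:C * inner H x x.
Proof.
move=> spt0 e0.
pose u (t : R) := t + -1 * (t0 * 1).
pose m (t : R) := Num.max (e ^+ 2) (u t * u t).
pose k (t : R) := u t * (m t)^-1.
pose h (t : R) := 1 + -1 * (u t * k t).
have m0 t : 0 < m t by rewrite lt_max exprn_gt0.
have cstc (c : R) : continuous (fun _ : R => c) by exact: cst_continuous.
have idc : continuous (@id R) by move=> ?; exact: cvg_id.
have uc : continuous u by exact: continuous_sub.
have uuc : continuous (fun t => u t * u t) by exact: continuous_mul.
have mc : continuous m.
  by move=> t; exact: (@continuous_max R R (fun=> e ^+ 2) _ t (cstc _ t) (uuc t)).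
have kc : continuous k.
  apply: continuous_mul => // t.
  by apply: continuousV; [rewrite gt_eqF|exact: mc].
have ukc : continuous (fun t => u t * k t) by exact: continuous_mul.
have hc : continuous h by exact: continuous_sub.
have W (f : R -> R) : continuous f -> {within sp, continuous f} by move=> ?; exact: continuous_subspaceT.
have Phiu x : Phi u x = A x - t0%:C *: x.
  rewrite (@fc_sub id (fun=> t0 * 1)); [|exact/W/idc|exact/W/cstc].
  by rewrite (fc_id fcPhi) (fc_scale fcPhi _ (W _ (cstc 1))) (fc_one fcPhi).
have [y hy] : exists y, Phi h y != 0.
  apply: contrapT => noy; apply: spt0.
  have Phih y : Phi h y = 0.
    by apply/eqP; apply/negPn/negP => hy; apply: noy; exists y.
  have Phiuk y : Phi (fun t => u t * k t) y = y.
    have := Phih y; rewrite (@fc_sub (fun=> 1) (fun t => u t * k t)); last exact: W.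
      by rewrite (fc_one fcPhi) => /eqP; rewrite subr_eq0 => /eqP.
    exact/W/cstc.
  have Phiku y : Phi (fun t => k t * u t) y = y.
    rewrite -[RHS]Phiuk; apply: fc_ext => [||t _]; [|exact: W|exact: mulrC].
    by apply: W; exact: continuous_mul.
  exists (Phi k); split=> y.
    by rewrite -Phiu -(fc_mul fcPhi) ?Phiku//; exact: W.
  by rewrite -Phiu -(fc_mul fcPhi) ?Phiuk//; exact: W.
exists (Phi h y) => //.
have uhc : continuous (fun t => u t * h t) by exact: continuous_mul.
have hhc : continuous (fun t => h t * h t) by exact: continuous_mul.
have uhuhc : continuous (fun t => (u t * h t) * (u t * h t)) by exact: continuous_mul.
have ehhc : continuous (fun t => e ^+ 2 * (h t * h t)) by exact: continuous_scale.
rewrite -Phiu -(fc_mul fcPhi); [|exact: W|exact: W].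
rewrite !fc_norm; [|exact: W|exact: W].
rewrite -fc_inner_scale; last exact: W.
apply: fc_le => [||t _]; [exact: W|exact: W|].
have -> : u t * h t * (u t * h t) = (u t * u t) * (h t * h t) by ring.
(* Where u^2 >= e^2 the bump [h] vanishes; elsewhere u^2 < e^2. *)
rewrite /h /k /m; case: (leP (e ^+ 2) (u t * u t)) => eu.
  have -> : 1 + -1 * (u t * (u t * (u t * u t)^-1)) = 0.
    rewrite mulrA divff ?mulr1 ?subrr// gt_eqF//.
    by apply: lt_le_trans eu; rewrite exprn_gt0.
  by rewrite !mulr0.
by rewrite ler_wpM2r ?(ltW eu)// -expr2 sqr_ge0.
Qed.

End calculus.
End functional_calculus.

(** * Bounds for the spectrum of a positive invertible operator *)

Section spectrum_bounds.
Context {R : realType} {H : hilbertSpace R}.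
Variables (A : boundedOp H) (Phi : (R -> R) -> boundedOp H).
Hypothesis fcPhi : is_functional_calculus A Phi.
Implicit Types (x : H) (t e : R).

Lemma approx_eigenvector_norm t e : real_spectrum A t -> 0 < e ->
  exists2 x, x != 0 & `|A x - t%:C *: x| <= e%:C * `|x|.
Proof.
move=> At e0; have [x x0 h] := approx_eigenvector fcPhi At e0; exists x => //.
rewrite -ler_sqr ?nnegrE ?mulr_ge0 ?ler0c ?(ltW e0)//.
by rewrite exprMn !inner_normE -rmorphXn.
Qed.

(** For t < 0, expanding the square gives |A x - t x|^2 >= t^2 |x|^2, against an approximate
    eigenvector of precision - t / 2. *)
Lemma real_spectrum_ge0 t : positive_op A -> real_spectrum A t -> 0 <= t.
Proof.
move=> Apos At; rewrite leNgt; apply/negP => t0.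
have e0 : 0 < - t / 2 by lra.
have [x x0 h] := approx_eigenvector fcPhi At e0.
have xx0 : 0 < inner H x x by rewrite dnorm_gt0.
have : (t ^+ 2)%:C * inner H x x <= ((- t / 2) ^+ 2)%:C * inner H x x.
  apply: le_trans h; rewrite dnormB dnormZ.
  have -> : `|t%:C| ^+ 2 = (t ^+ 2)%:C :> R[i].
    by rewrite normc_def /= expr0n addr0 sqrtr_sqr -rmorphXn /= real_normK ?num_real.
  have d0 : inner H (A x) (t%:C *: x) <= 0.
    have tC0 : t%:C <= 0 :> R[i] by rewrite lecR ltW.
    by rewrite linearZr_LR /= conj_Creal ?ler0_real// mulr_le0_ge0 ?Apos.
  have dJ : (inner H (A x) (t%:C *: x))^* <= 0.
    by rewrite (conj_Creal (ler0_real d0)).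
  rewrite addrAC lerDr subr_ge0.
  by apply: le_trans (dnorm_ge0 _ _); rewrite -[leRHS]addr0 lerD.
by rewrite ler_pM2r// lecR; nra.
Qed.

Lemma real_spectrum_bounded : positive_op A -> invertible_op A ->
  exists m M, 0 < m /\ forall t, real_spectrum A t -> m <= t <= M.
Proof.
move=> Apos [S [SA _]].
have [c c0 hc] := boundedOp_bound S; have [d d0 hd] := boundedOp_bound A.
have norm_gt0 x : x != 0 -> 0 < `|x| by rewrite normr_gt0.
(* If t < 1 / (2 c), an approximate eigenvector of precision 1 / (2 c) gives |x| <= c |A x| < |x|.
   Precision 1 gives t <= d + 1. *)
exists (2 * c)^-1, (d + 1); split; first by rewrite invr_gt0 mulr_gt0.
move=> t At; have t0 := real_spectrum_ge0 Apos At.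
have tn x : `|t%:C *: x| = t%:C * `|x|.
  by rewrite normrZ ger0_norm// ler0c.
apply/andP; split.
  rewrite leNgt; apply/negP => tc.
  have e0 : 0 < (2 * c)^-1 by rewrite invr_gt0 mulr_gt0.
  have [x x0 h] := approx_eigenvector_norm At e0.
  have : `|x| <= (c * ((2 * c)^-1 + t))%:C * `|x|.
    rewrite -{1}(SA x); apply: (le_trans (hc _)).
    rewrite rmorphM -mulrA ler_pM2l ?ltcR// rmorphD mulrDl.
    rewrite -[A x](subrK (t%:C *: x)); apply: (le_trans (ler_normD _ _)).
    by rewrite tn lerD2r.
  rewrite -[X in X <= _]mul1r ler_pM2r ?norm_gt0// -(rmorph1 (real_complex R)) lecR.
  apply/negP; rewrite -ltNge.
  have : c * t < c * (2 * c)^-1 by rewrite ltr_pM2l.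
  have : c * (2 * c)^-1 = 2^-1 by field; exact: lt0r_neq0.
  by move=> e1; rewrite mulrDr e1; lra.
have [x x0 h] := approx_eigenvector_norm At ltr01.
rewrite -lecR -(@ler_pM2r _ `|x|) ?norm_gt0// -tn rmorphD mulrDl.
have -> : t%:C *: x = A x - (A x - t%:C *: x) by rewrite opprB addrC subrK.
by apply: (le_trans (ler_normB _ _)); apply: lerD.
Qed.

End spectrum_bounds.

(** * Continuous functions with positive bounds form a mean class *)

Section continuous_mean_class.
Context {R : realType} {T : topologicalType}.
Implicit Types (K : set T) (f g : T -> R) (t : T) (e : R).

Definition bounded_continuous K f :=
  (exists l u, 0 < l /\ forall t, K t -> l <= f t <= u) /\ {within K, continuous f}.

Lemma within_continuous_inv K f : (forall t, K t -> f t != 0) ->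
  {within K, continuous f} -> {within K, continuous (fun t => (f t)^-1)}.
Proof.
move=> f0 /subspace_continuousP fc; apply/subspace_continuousP => t Kt.
by apply: cvgV; [exact: f0|exact: fc].
Qed.

Lemma bounded_continuous_inv K f :
  bounded_continuous K f -> bounded_continuous K (fun t => (f t)^-1).
Proof.
move=> [[l [u [l0 h]]] fc].
have f0 t : K t -> 0 < f t by move=> /h/andP[+ _]; exact: lt_le_trans.
split; last by apply: within_continuous_inv => // t Kt; rewrite gt_eqF ?f0.
(* The maximum is positive even when [K] is empty. *)
exists (Num.max l u)^-1, l^-1; split; first by rewrite invr_gt0 lt_max l0.
move=> t Kt; have /andP[lf fu] := h t Kt.
by rewrite !lef_pV2 ?posrE ?f0 ?lt_max ?l0// le_max fu orbT.
Qed.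

Lemma bounded_continuous_add K f g : bounded_continuous K f ->
  bounded_continuous K g -> bounded_continuous K (fun t => f t + g t).
Proof.
move=> [[l [u [l0 h]]] fc] [[l' [u' [l0' h']]] gc].
split; last exact: continuous_add.
exists (l + l'), (u + u'); split; first exact: addr_gt0.
by move=> t Kt; have /andP[? ?] := h t Kt; have /andP[? ?] := h' t Kt; rewrite !lerD.
Qed.

Lemma expR_sub1_le e : 0 <= e <= 1 -> expR e - 1 <= e * expR 1.
Proof.
move=> /andP[e0 e1]; have := expR_ge1Dx (- e); rewrite expRN => h.
have E0 := expR_gt0 e; have := ler_wpM2r (ltW E0) h; rewrite mulVf ?gt_eqF//.
have : e * expR e <= e * expR 1 by rewrite ler_wpM2l// ler_expR.
lra.
Qed.

Lemma within_continuous_log_close K f u : (forall t, K t -> 0 < f t <= u) ->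
  (forall e, 0 < e -> exists2 g, {within K, continuous g} & log_close K e f g) ->
  {within K, continuous f}.
Proof.
move=> fu fg; apply/subspace_continuousP => t Kt.
have u0 : 0 < u by have /andP[h1 h2] := fu _ Kt; exact: lt_le_trans h2.
apply/cvgrPdist_le => d d0.
have C0 : 0 < 3 * expR 1 * expR 1 * u :> R by rewrite !mulr_gt0 ?expR_gt0//.
(* As e <= 1, g is at most expR 1 * u and expR e - 1 at most e * expR 1; their product is then at
   most a third of [d]. *)
pose e := Num.min 1 (d / (3 * expR 1 * expR 1 * u)).
have e0 : 0 < e by rewrite lt_min ltr01 divr_gt0.
have e1 : e <= 1 by rewrite ge_min lexx.
have ed : e * (expR 1 * expR 1 * u) <= d / 3.
  have : e <= d / (3 * expR 1 * expR 1 * u) by rewrite ge_min lexx orbT.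
  rewrite ler_pdivlMr// => h; lra.
have [g gc fge] := fg e e0.
have close s : K s -> `|f s - g s| <= d / 3.
  move=> Ks; have [h1 h2] := fge _ Ks; have /andP[f0 fsu] := fu _ Ks.
  have E := expR_sub1_le (introT andP (conj (ltW e0) e1)).
  have Ee1 : expR e <= expR 1 by rewrite ler_expR.
  have Ege1 : 1 <= expR e by have := expR_ge1Dx e; lra.
  have E1 : 1 <= expR 1 :> R by have := expR_ge1Dx (1 : R); lra.
  set x := expR e in h1 h2 E Ee1 Ege1; set y := expR 1 in ed E Ee1 E1.
  have xu : (x - 1) * y * u <= d / 3.
    have yu : 0 < y * u by rewrite mulr_gt0//; lra.
    by move: E; rewrite -(ler_pM2r yu) => E; apply: le_trans ed; lra.
  have g0 : 0 < g s by nra.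
  have gyu : g s <= y * u.
    by apply: (le_trans h2); apply: ler_pM => //; lra.
  have k1 : f s - g s <= (x - 1) * (y * u).
    by apply: (@le_trans _ _ ((x - 1) * g s)); [lra|rewrite ler_wpM2l//; lra].
  have k2 : g s - f s <= (x - 1) * (y * u).
    apply: (@le_trans _ _ ((x - 1) * f s)); first lra.
    by rewrite ler_wpM2l//; [lra|apply: (le_trans fsu); rewrite ler_peMl//; lra].
  by rewrite ler_norml; apply/andP; split; lra.
have d3 : 0 < d / 3 by lra.
have /subspace_continuousP/(_ t Kt)/cvgrPdist_le/(_ _ d3) gct := gc.
near=> s.
have Ks : K s by near: s; exact: withinT.
have h3 : `|g t - g s| <= d / 3 by near: s.
have -> : f t - f s = (f t - g t) + (g t - g s) + - (f s - g s) by ring.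
apply: (le_trans (ler_normD _ _)); rewrite normrN.
have := ler_normD (f t - g t) (g t - g s).
have := close _ Kt; have := close _ Ks; lra.
Unshelve. all: by end_near. Qed.

Lemma mean_class_continuous K : mean_class K (bounded_continuous K).
Proof.
split.
- by move=> f [].
- by split; [exists 1, 1; split=> // t _; rewrite lexx|move=> t; exact: cvg_cst].
- move=> c f c0 [[l [u [l0 h]]] fc]; split; last exact: continuous_scale.
  exists (c * l), (c * u); split; first exact: mulr_gt0.
  by move=> t /h/andP[? ?]; rewrite !ler_pM2l//; apply/andP.
- by move=> f g; exact: bounded_continuous_add.
- move=> f g /bounded_continuous_inv fc /bounded_continuous_inv gc.
  exact/bounded_continuous_inv/bounded_continuous_add.
- move=> f hf; have [g [[l [u [l0 h]]] gc] fg] := hf 1 ltr01.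
  have fb t : K t -> (expR 1)^-1 * l <= f t <= expR 1 * u.
    move=> Kt; have [h1 h2] := fg t Kt; have /andP[? ?] := h t Kt.
    have E0 := expR_gt0 (1 : R).
    apply/andP; split; last by apply: (le_trans h1); rewrite ler_pM2l.
    by rewrite mulrC ler_pdivrMr// mulrC; exact: le_trans h2.
  have El : 0 < (expR 1)^-1 * l by rewrite mulr_gt0 ?invr_gt0 ?expR_gt0.
  split; first by exists ((expR 1)^-1 * l), (expR 1 * u).
  apply: (@within_continuous_log_close K f (expR 1 * u)).
    by move=> t /fb/andP[h1 h2]; rewrite (lt_le_trans El h1).
  by move=> e /hf[k [_ kc] fk]; exists k.
Qed.

End continuous_mean_class.

(** * Functions preserving one operator inequality form a mean class *)

Section operator_mean_class.
Context {R : realType} {H : hilbertSpace R}.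

(** [Phi f] and [Phi] of 1/f are mutually inverse, so this is order reversal under operator
    inversion. *)
Lemma fc_op_le_inv (A B : boundedOp H) (PhiA PhiB : (R -> R) -> boundedOp H)
    (K : set R) (f : R -> R) :
  is_functional_calculus A PhiA -> is_functional_calculus B PhiB ->
  real_spectrum A `<=` K -> real_spectrum B `<=` K ->
  {within K, continuous f} -> (forall t, K t -> 0 < f t) ->
  op_le (PhiA f) (PhiB f) ->
  op_le (PhiB (fun t => (f t)^-1)) (PhiA (fun t => (f t)^-1)).
Proof.
move=> fcA fcB AK BK fK f0 fle.
have ifK : {within K, continuous (fun t => (f t)^-1)}.
  by apply: within_continuous_inv => // t Kt; rewrite gt_eqF ?f0.
have inv (C : boundedOp H) (Phi : (R -> R) -> boundedOp H) x :
    is_functional_calculus C Phi -> real_spectrum C `<=` K ->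
    Phi f (Phi (fun t => (f t)^-1) x) = x.
  move=> fcC CK.
  have fC := continuous_subspaceW CK fK; have ifC := continuous_subspaceW CK ifK.
  have c1 : {within real_spectrum C, continuous (fun _ : R => 1 : R)}.
    by move=> t; exact: cvg_cst.
  have fifC := continuous_mul fC ifC.
  rewrite -(fc_mul fcC)// -[RHS](fc_one fcC).
  by apply: (fc_ext fcC) => // t /CK Kt; rewrite divff// gt_eqF ?f0.
apply: (op_le_inv (X := PhiA f) (Y := PhiB f)) => // [x|x y|x|x|x].
- by apply: (fc_ge0 fcA) => [|t /AK/f0/ltW//]; exact: continuous_subspaceW fK.
- by apply: (fc_adjoint fcA); exact: continuous_subspaceW fK.
- apply: (fc_ge0 fcB) => [|t /BK/f0 ft0]; first exact: continuous_subspaceW ifK.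
  by rewrite invr_ge0 ltW.
- exact: inv fcA AK.
- exact: inv fcB BK.
Qed.

Variables (A B : boundedOp H) (PhiA PhiB : (R -> R) -> boundedOp H) (K : set R).
Hypotheses (fcA : is_functional_calculus A PhiA)
  (fcB : is_functional_calculus B PhiB)
  (AK : real_spectrum A `<=` K) (BK : real_spectrum B `<=` K).

Lemma mean_class_op_le :
  mean_class K (fun f => bounded_continuous K f /\ op_le (PhiA f) (PhiB f)).
Proof.
have mcC := @mean_class_continuous R _ K.
have cA (f : R -> R) : bounded_continuous K f -> {within real_spectrum A, continuous f}.
  by move=> [_]; exact: continuous_subspaceW.
have cB (f : R -> R) : bounded_continuous K f -> {within real_spectrum B, continuous f}.
  by move=> [_]; exact: continuous_subspaceW.
split.
- by move=> f [/(mc_bounded mcC)].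
- split; first exact: mc_one mcC.
  by apply/op_leE => x; rewrite (fc_one fcA) (fc_one fcB).
- move=> c f c0 [fc /op_leE fle]; split; first exact: (mc_scale mcC).
  apply/op_leE => x; rewrite (fc_inner_scale fcA _ _ (cA _ fc)).
  by rewrite (fc_inner_scale fcB _ _ (cB _ fc)) ler_wpM2l// ler0c ltW.
- move=> f g [fc /op_leE fle] [gc /op_leE gle]; split; first exact: (mc_add mcC).
  apply/op_leE => x; rewrite (fc_add fcA (cA _ fc) (cA _ gc)).
  by rewrite (fc_add fcB (cB _ fc) (cB _ gc)) !linearDl; apply: lerD; [exact: fle|exact: gle].
- move=> f g [fc fle] [gc gle]; split; first exact: (mc_par mcC).
  have ifc := bounded_continuous_inv fc; have igc := bounded_continuous_inv gc.
  have fgc := mc_add mcC ifc igc.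
  (* The inverses satisfy the reversed inequality, so [A] and [B] change roles for the outer
     inversion. *)
  apply: (fc_op_le_inv fcB fcA BK AK) => [|t Kt|]; first by case: fgc.
    exact: (mc_gt0 mcC fgc Kt).
  have /op_leE fle' := fc_op_le_inv fcA fcB AK BK fc.2 (fun t Kt => mc_gt0 mcC fc Kt) fle.
  have /op_leE gle' := fc_op_le_inv fcA fcB AK BK gc.2 (fun t Kt => mc_gt0 mcC gc Kt) gle.
  apply/op_leE => x; rewrite (fc_add fcA (cA _ ifc) (cA _ igc)).
  by rewrite (fc_add fcB (cB _ ifc) (cB _ igc)) !linearDl; apply: lerD; [exact: fle'|exact: gle'].
- move=> f hf; have fc : bounded_continuous K f.
    by apply: (mc_closed mcC) => e /hf[g [gc _] fg]; exists g.
  split=> //; apply/op_leE => x.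
  have f0 t : K t -> 0 <= f t by move=> /(mc_gt0 mcC fc)/ltW.
  have [a aE] : exists a : R, inner H (PhiA f x) x = a%:C.
    apply/complex_realP/ger0_real/(fc_ge0 fcA) => [|t /AK/f0//]; exact: cA.
  have [b bE] : exists b : R, inner H (PhiB f x) x = b%:C.
    apply/complex_realP/ger0_real/(fc_ge0 fcB) => [|t /BK/f0//]; exact: cB.
  have b0 : 0 <= b.
    by rewrite -ler0c -bE; apply: (fc_ge0 fcB) => [|t /BK/f0//]; exact: cB.
  (* Pass from [f] to [g] at [A] and back at [B], losing a factor expR e each time. *)
  have ab e : 0 < e -> a <= expR e * (expR e * b).
    move=> /hf[g [gc /op_leE gle] fg].
    have gcA := cA _ gc; have gcB := cB _ gc; have fcA' := cA _ fc; have fcB' := cB _ fc.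
    rewrite -lecR 2!rmorphM /= -aE -bE.
    apply: (@le_trans _ _ ((expR e)%:C * inner H (PhiA g x) x)).
      rewrite -(fc_inner_scale fcA)//; apply: (fc_le fcA) => //.
        exact: continuous_scale.
      by move=> t /AK/fg[].
    rewrite ler_wpM2l ?ler0c ?expR_ge0//; apply: (le_trans (gle x)).
    rewrite -(fc_inner_scale fcB)//; apply: (fc_le fcB) => //.
      exact: continuous_scale.
    by move=> t /BK/fg[].
  rewrite aE bE lecR leNgt; apply/negP => ba.
  have [b_eq0|b_neq0] := eqVneq b 0.
    by have := ab 1 ltr01; rewrite b_eq0 !mulr0; lra.
  have bp : 0 < b by rewrite lt0r b_neq0.
  have ba1 : 1 < a / b by rewrite ltr_pdivlMr// mul1r.
  have a0 : 0 < a by exact: lt_trans ba.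
  (* For e = ln (a / b) / 3 the two factors amount to (a / b)^(2/3) < a / b. *)
  have l0 := ln_gt0 ba1; have e0 : 0 < ln (a / b) / 3 by lra.
  have := ab _ e0; rewrite mulrA -expRD -ler_pdivrMr// leNgt => /negP; apply.
  rewrite -[ltRHS]lnK ?posrE ?divr_gt0// ltr_expR; lra.
Qed.

End operator_mean_class.

(** * Operator monotonicity of the product *)

Lemma stolarsky_prodE {R : realType} n (gamma : R) (alpha beta : 'I_n -> R) (t : R) :
  t `^ gamma * \prod_(i < n) stolarsky (alpha i) (beta i) t =
  if t == 1 then \prod_(i < n) (alpha i / beta i)
  else t `^ gamma * \prod_(i < n) ((t `^ alpha i - 1) / (t `^ beta i - 1)).
Proof.
case: ifPn => [/eqP ->|t1].
  by rewrite powR1 mul1r; apply: eq_bigr => i _; rewrite /stolarsky eqxx.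
by congr (_ * _); apply: eq_bigr => i _; rewrite /stolarsky (negbTE t1).
Qed.

Theorem theorem1p1 (R : realType) (n : nat) (hn : (1 <= n)%N)
  (gamma : R) (hgamma : `|gamma| <= 2)
  (alpha beta : 'I_n -> R)
  (halpha : forall i, 0 < alpha i <= 2)
  (hbeta : forall i, 0 < beta i <= 2)
  (hne : forall i j, alpha i != beta j)
  (halpha_mono : forall i j : 'I_n, (i < j)%N -> alpha i <= alpha j)
  (hbeta_mono : forall i j : 'I_n, (i < j)%N -> beta i <= beta j)
  (hlow : 0 <= gamma - \sum_(i < n) F (beta i) (alpha i))
  (hupp : gamma + \sum_(i < n) F (alpha i) (beta i) <= 1) :
  operator_monotone (fun t : R =>
    if t == 1 then \prod_(i < n) (alpha i / beta i)
    else t `^ gamma *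
         \prod_(i < n) ((t `^ alpha i - 1) / (t `^ beta i - 1))).
Proof.
set g := (X in operator_monotone X).
have gE t : t `^ gamma * \prod_(i < n) stolarsky (alpha i) (beta i) t = g t.
  exact: stolarsky_prodE.
(* Every mean class containing the identity contains [g]; both halves of operator monotonicity are
   instances. *)
have main (K : set R) (P : (R -> R) -> Prop) : mean_class K P -> P id -> P g.
  move=> mcP Pid.
  apply: (mc_eq mcP (mc_stolarsky_prod mcP Pid halpha hbeta (fun i => hne i i) hlow hupp)).
  by move=> t _; exact: gE.
have id_continuous (K : set R) : {within K, continuous (@id R)}.
  by apply: continuous_subspaceT => t; exact: cvg_id.
split.
  have o : open [set t : R | 0 < t] by exact: open_gt.
  rewrite continuous_open_subspace// => t0; rewrite inE /= => t0_gt0.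
  (* A neighbourhood of [t0] on which the identity has positive bounds; being open, it turns
     continuity within [K] into continuity at [t0]. *)
  pose K := [set t : R | t0 / 2 < t < 2 * t0].
  have Kid : bounded_continuous K id.
    split=> //; exists (t0 / 2), (2 * t0); split; first by lra.
    by move=> t /andP[/ltW h1 /ltW h2]; apply/andP.
  have [_] := main K _ (mean_class_continuous K) Kid.
  have oK : open K.
    rewrite (_ : K = [set t | t0 / 2 < t] `&` [set t | t < 2 * t0]).
      by apply: openI; [exact: open_gt|exact: open_lt].
    by apply/seteqP; split => t; [move=> /andP[]|move=> [? ?]; apply/andP].
  rewrite continuous_open_subspace//; apply; rewrite inE /K /=.
  by apply/andP; split; lra.
move=> H A B PhiA PhiB A0 Ainv B0 Binv fcA fcB AB.
have [m [M [m0 hA]]] := real_spectrum_bounded fcA A0 Ainv.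
have [m' [M' [m0' hB]]] := real_spectrum_bounded fcB B0 Binv.
(* One interval with positive bounds containing both spectra. *)
pose K := [set t : R | Num.min m m' <= t <= Num.max M M'].
have AK : real_spectrum A `<=` K.
  by move=> t /hA/andP[h1 h2]; rewrite /K /= ge_min h1 le_max h2.
have BK : real_spectrum B `<=` K.
  by move=> t /hB/andP[h1 h2]; rewrite /K /= ge_min h1 orbT le_max h2 orbT.
have idP : bounded_continuous K id /\ op_le (PhiA id) (PhiB id).
  split; first split=> //.
    by exists (Num.min m m'), (Num.max M M'); split; first by rewrite lt_min m0.
  by apply/op_leE => x; rewrite (fc_id fcA) (fc_id fcB); move: x; exact/op_leE.
by have [] := main K _ (mean_class_op_le fcA fcB AK BK) idP.
Qed.
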